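(* Let $\mathcal{H}$ be a real Hilbert space and $T:\mathcal{H}\to\mathcal{H}$ a nonexpansive operator with $\mathrm{Fix}\,T\ne\emptyset$. Let $\alpha>1$. For given $x_0,v\in\mathcal{H}$, let $(x_k)_{k\ge0}$ be generated by $$x_{k+1}:=\frac{\alpha-1}{k+\alpha}\,v+\left(1-\frac{\alpha-1}{k+\alpha}\right)T(x_k)\quad\forall k\ge0 .$$ Then the following statements are true: (i) as $k\to+\infty$ it holds $$\|x_{k+1}-x_k\|=\mathcal{O}\left(\frac{1}{k^{\min\{\alpha-1,1\}}}\right),\qquad\|x_{k+1}-T(x_{k+1})\|=\mathcal{O}\left(\frac{1}{k^{\min\{\alpha-1,1\}}}\right);$$ (ii) $(x_k)_{k\ge0}$ converges strongly to $\xi_*:=P_{\mathrm{Fix}\,T}(v)$ as $k\to+\infty$.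
   Context: $T$ is nonexpansive if $\|T(x)-T(y)\|\le\|x-y\|$ for all $x,y\in\mathcal{H}$. $\mathrm{Fix}\,T:=\{x\in\mathcal{H}:x=T(x)\}$, which is closed and convex; $P_{\mathrm{Fix}\,T}$ denotes the metric projection onto it. *)

(* Defs.v *)
From HB Require Import structures.
From mathcomp Require Import all_boot all_order all_algebra sesquilinear.
From mathcomp Require Import all_classical all_reals all_analysis ring lra.

Set Implicit Arguments.
Unset Strict Implicit.
Unset Printing Implicit Defensive.

Import Order.TTheory GRing.Theory Num.Theory.
Import numFieldNormedType.Exports.

Local Open Scope classical_set_scope.
Local Open Scope ring_scope.

HB.mixin Record CompleteNormedModule_isHilbert (R : realType) H
    of CompleteNormedModule R H := {
  inner : {dot H for (@idfun R)} ;
  norm_inner : forall x : H, `|x| = Num.sqrt (inner x x)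
}.

#[short(type="hilbertType")]
HB.structure Definition Hilbert (R : realType) :=
  {H of CompleteNormedModule_isHilbert R H & CompleteNormedModule R H}.

Definition nonexpansive (R : realType) (H : normedModType R) (T : H -> H) :=
  forall x y : H, `|T x - T y| <= `|x - y|.

Definition Fix (H : Type) (T : H -> H) : set H := [set x | x = T x].

Definition is_metric_projection (R : realType) (H : normedModType R)
    (C : set H) (v p : H) :=
  C p /\ forall y, C y -> `|v - p| <= `|v - y|.

(* [get] picks a minimizer: by [metric_projectionP] and
   [metric_projection_unique] below there is exactly one when C is nonempty,
   closed and convex. *)
Definition metric_projection (R : realType) (H : normedModType R)
    (C : set H) (v : H) : H :=
  get (is_metric_projection C v).

Section HilbertTheory.
Context {R : realType} {H : hilbertType R}.
Implicit Types (x y z v p q : H) (C : set H) (T : H -> H).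

Lemma sqr_norm x : `|x| ^+ 2 = inner x x.
Proof.
rewrite norm_inner sqr_sqrtr//; have [->|x0] := eqVneq x 0.
  by rewrite linear0l.
exact/ltW/neq0_dnorm_gt0.
Qed.

Lemma innerC x y : inner x y = inner y x.
Proof. by rewrite hermC/= expr0 mul1r. Qed.

Lemma innerBl x y z : inner (x - y) z = inner x z - inner y z.
Proof. exact: linearBl. Qed.

Lemma innerDl x y z : inner (x + y) z = inner x z + inner y z.
Proof. exact: linearDl. Qed.

Lemma innerZl (t : R) x y : inner (t *: x) y = t * inner x y.
Proof. exact: linearZl_LR. Qed.

Lemma innerBr x y z : inner x (y - z) = inner x y - inner x z.
Proof. exact: linearBr. Qed.

Lemma innerDr x y z : inner x (y + z) = inner x y + inner x z.
Proof. exact: linearDr. Qed.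

Lemma innerZr (t : R) x y : inner x (t *: y) = t * inner x y.
Proof. exact: linearZr_LR. Qed.

(* Stewart's identity: the parallelogram law when t = 1 / 2. *)
Lemma sqr_norm_conv (t : R) x y z :
  `|z - (t *: x + (1 - t) *: y)| ^+ 2 =
  t * `|z - x| ^+ 2 + (1 - t) * `|z - y| ^+ 2 - t * (1 - t) * `|x - y| ^+ 2.
Proof.
rewrite !sqr_norm !(innerBl, innerBr) !(innerDl, innerDr) !(innerZl, innerZr).
by rewrite (innerC y x) (innerC x z) (innerC y z); ring.
Qed.

Lemma closed_Fix T : nonexpansive T -> closed (Fix T).
Proof.
move=> neT x clx; apply/eqP; rewrite -subr_eq0 -normr_le0.
apply/ler_addgt0Pr => e e0; rewrite add0r.
have e20 : 0 < e / 2 by rewrite divr_gt0.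
have [y [Ty]] := clx _ (nbhsx_ballx x _ e20).
rewrite -ball_normE/= => xy.
rewrite -(subrKA y) (le_trans (ler_normD _ _))// [leRHS]splitr lerD ?ltW//.
by rewrite [in X in `|X|]Ty (le_lt_trans (neT _ _))// distrC.
Qed.

Lemma convex_Fix T : nonexpansive T ->
  convex_set (Fix T : set (convex_lmodType H)).
Proof.
move=> neT; suff FixT (t : R) x y : 0 <= t <= 1 -> Fix T x -> Fix T y ->
    Fix T (t *: x + (1 - t) *: y).
  move=> x y l; rewrite !inE => Tx Ty; apply: FixT => //.
  by apply/andP; split.
move=> /andP[t0 t1] Tx Ty; rewrite /Fix/=; set z := _ + _.
apply/esym/eqP; rewrite -subr_eq0 -normr_eq0 -sqrf_eq0.
rewrite eq_le sqr_ge0 andbT sqr_norm_conv.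
have hx : `|T z - x| <= (1 - t) * `|x - y|.
  rewrite [in leLHS]Tx (le_trans (neT _ _))//.
  rewrite -[X in X * _]ger0_norm ?subr_ge0// -normrZ -normrN.
  suff -> : - (z - x) = (1 - t) *: (x - y) by [].
  by rewrite opprB /z scalerBr [(1 - t) *: x]scalerBl scale1r opprD addrA.
have hy : `|T z - y| <= t * `|x - y|.
  rewrite [in leLHS]Ty (le_trans (neT _ _))//.
  rewrite -[X in X * _]ger0_norm// -normrZ.
  suff -> : z - y = t *: (x - y) by [].
  by rewrite /z [(1 - t) *: y]scalerBl scale1r scalerBr addrA addrAC addrK.
have hx2 : `|T z - x| ^+ 2 <= ((1 - t) * `|x - y|) ^+ 2.
  by rewrite lerXn2r// nnegrE// mulr_ge0// subr_ge0.
have hy2 : `|T z - y| ^+ 2 <= (t * `|x - y|) ^+ 2.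
  by rewrite lerXn2r// nnegrE// mulr_ge0.
have s0 : 0 <= 1 - t by rewrite subr_ge0.
have := lerD (ler_wpM2l t0 hx2) (ler_wpM2l s0 hy2).
by rewrite -subr_le0; apply: le_trans; rewrite le_eqVlt; apply/orP; left;
  apply/eqP; ring.
Qed.

Lemma near_minimizers C v (d e1 e2 : R) y1 y2 :
    convex_set (C : set (convex_lmodType H)) ->
    (forall y, C y -> d <= `|v - y| ^+ 2) -> C y1 -> C y2 ->
    `|v - y1| ^+ 2 <= d + e1 -> `|v - y2| ^+ 2 <= d + e2 ->
  `|y1 - y2| ^+ 2 <= 2 * (e1 + e2).
Proof.
move=> cC dC Cy1 Cy2 h1 h2.
have h0 : 0 <= (2^-1 : R) by lra.
have h01 : (2^-1 : R) <= 1 by lra.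
have /dC : C (2^-1 *: y1 + (1 - 2^-1) *: y2).
  by have := cC y1 y2 (Itv01 h0 h01); rewrite !inE; exact.
by rewrite sqr_norm_conv; lra.
Qed.

Lemma metric_projectionP C v : closed C ->
    convex_set (C : set (convex_lmodType H)) ->
    C !=set0 ->
  is_metric_projection C v (metric_projection C v).
Proof.
move=> clC cC [y0 Cy0]; rewrite /metric_projection.
suff : exists p, is_metric_projection C v p by move=> exP; exact: (xgetPex _ exP).
pose D : set R := [set `|v - y| ^+ 2 | y in C].
have D0 : lbound D 0 by move=> _ [y _ <-]; exact: sqr_ge0.
have lbD : has_lbound D by exists 0.
have infD : has_inf D by split=> //; exists (`|v - y0| ^+ 2), y0.
have leD y : C y -> inf D <= `|v - y| ^+ 2.
  by move=> Cy; apply: ge_inf => //; exists y.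
have /choice[u uP] : forall n : nat, exists y,
    C y /\ `|v - y| ^+ 2 <= inf D + n.+1%:R^-1.
  move=> n; have n0 : 0 < n.+1%:R^-1 :> R by rewrite invr_gt0.
  by have [_ [y Cy <-] /ltW] := inf_adherent n0 infD; exists y.
have inv0 : (fun n : nat => n.+1%:R^-1 : R) @ \oo --> (0 : R).
  exact: cvg_harmonic.
have /cvg_ex[/= p up] : cvg (u @ \oo).
  apply/cauchy_cvgP/cauchy_exP => e e0.
  have e40 : 0 < e ^+ 2 / 4 by rewrite divr_gt0// exprn_gt0.
  have [N _ hN] : \forall n \near \oo, n.+1%:R^-1 < e ^+ 2 / 4.
    have /cvgrPdist_lt/(_ _ e40) := inv0.
    apply: filterS => n; rewrite sub0r normrN ger0_norm ?invr_ge0//.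
  exists (u N), N => // n /= Nn; rewrite -ball_normE/=.
  rewrite -(@ltr_pXn2r _ 2)// ?nnegrE ?(ltW e0)//.
  have uNn := near_minimizers cC leD (uP N).1 (uP n).1 (uP N).2 (uP n).2.
  have /= hNN := hN N (leqnn N); have /= hNn := hN n Nn.
  apply: (le_lt_trans uNn).
  by move: (N.+1%:R^-1 : R) (n.+1%:R^-1 : R) hNN hNn => a b;
    move: (e ^+ 2) => c; lra.
exists p; split.
  apply: (@closed_cvg _ _ (@eventually) _ u C clC _ p up).
  by apply: nearW => n; exact: (uP n).1.
move=> y Cy; rewrite -(@ler_pXn2r _ 2)// ?nnegrE//.
apply: le_trans (leD _ Cy).
have h1 : `|v - u n| ^+ 2 @[n --> \oo] --> `|v - p| ^+ 2.
  rewrite expr2; under eq_fun do rewrite expr2.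
  have : `|v - u n| @[n --> \oo] --> `|v - p|.
    by apply: cvg_norm; apply: cvgB => //; exact: cvg_cst.
  by move=> h; apply: cvgM.
have h2 : (inf D + n.+1%:R^-1) @[n --> \oo] --> inf D.
  by rewrite -[X in _ --> X]addr0; apply: cvgD => //; exact: cvg_cst.
rewrite -(cvg_lim _ h1)// -(cvg_lim _ h2)//.
apply: ler_lim; [by apply/cvg_ex; eexists; exact: h1|
  by apply/cvg_ex; eexists; exact: h2|].
by near=> n; exact: (uP n).2.
Unshelve. all: by end_near. Qed.

Lemma metric_projection_unique C v p q :
    convex_set (C : set (convex_lmodType H)) ->
  is_metric_projection C v p -> is_metric_projection C v q -> p = q.
Proof.
move=> cC [Cp pP] [Cq qP]; apply/eqP; rewrite -subr_eq0 -normr_eq0 -sqrf_eq0.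
rewrite eq_le sqr_ge0 andbT -[leRHS](mulr0 2) -[X in 2 * X](addr0 0).
apply: (near_minimizers (v := v) (d := `|v - p| ^+ 2) cC) => // [y Cy||].
- by rewrite lerXn2r ?nnegrE// pP.
- by rewrite addr0.
- by rewrite addr0 lerXn2r ?nnegrE// qP.
Qed.

Corollary metric_projection_Fix T v : nonexpansive T -> Fix T !=set0 ->
  is_metric_projection (Fix T) v (metric_projection (Fix T) v).
Proof.
move=> neT FixT0.
by apply: metric_projectionP => //; [exact: closed_Fix|exact: convex_Fix].
Qed.

End HilbertTheory.

(* Main.v *)
Require Import Defs.
From mathcomp Require Import all_boot all_order all_algebra.
From mathcomp Require Import all_classical all_reals all_analysis.
From mathcomp Require Import ring lra.

Import Order.TTheory GRing.Theory Num.Theory.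
Import numFieldNormedType.Exports.

Local Open Scope classical_set_scope.
Local Open Scope ring_scope.

(** Write [A = I - T], which is cocoercive, [m = min (alpha - 1) 1] and
    [lambda k = (alpha - 1) / (k + alpha)]. The sequence stays bounded, and
    [A x_k = lambda_k (v - T x_k) - (x_(k+1) - x_k)] with [lambda_k = O(1/k)],
    so for (i) it suffices to bound one of the two quantities.

    If [alpha <> 2], bound the steps. They satisfy
    [d_(k+1) <= (k + 2) / (k + 1 + alpha) d_k + O(1 / k^2)]: for [alpha > 2]
    an induction gives [d_k = O(1 / k)] ([halpern_step_rate_gt2]); for
    [alpha < 2] the forcing term can be absorbed into [d_k], and Bernoulli's
    inequality shows that the contraction factors multiply to
    [O(k^(1 - alpha))] ([powR_decay], [halpern_step_rate_lt2]). If
    [alpha = 2], this recursion only gives [O(log k / k)]; instead the energy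
    [k (k + 1) / 2 |A x_k|^2 + (k + 1) <x_k - v, A x_k>] is nonincreasing by
    cocoercivity, which bounds the residual ([halpern_energy_step],
    [halpern_residual_rate_eq2]).

    For (ii), no weak compactness is needed. Browder's path, the solutions [z]
    of [A z = mu (v - z)], converges strongly as [mu] decreases to [0], because
    monotonicity of [A] makes [|v - z|] monotone and bounded and controls the
    distances between points of the path; the limit [p] is the projection of
    [v] onto the fixed points ([browder_path_cvg]). Comparing an approximate
    fixed point [y] with a point of the path shows that [<v - p, y - p>] is
    almost nonpositive ([approx_fixed_variational]). Since [A x_k] tends to
    [0] by (i), the inequality
    [|x_(k+1) - p|^2 <= (1 - lambda_k) |x_k - p|^2
                        + 2 lambda_k <v - p, x_(k+1) - p>]
    forces [x_k] to converge to [p] ([halpern_cvg]). *)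

(** * Contraction recursions with power decay *)

Section PowerDecay.
Context {R : realType}.
Implicit Types (c s t B beta m : R) (e : nat -> R).

(** Bernoulli's inequality for an exponent in [0, 1]: convexity of the
    exponential along the segment from [0] to [ln (1 + t)]. *)
Lemma powR1D_le t m : 0 <= t -> 0 <= m <= 1 -> (1 + t) `^ m <= 1 + m * t.
Proof.
move=> t0 /andP[m0 m1]; have t1 : 0 < 1 + t by lra.
have := convex_expR (Itv01 m0 m1) (ln (1 + t)) 0.
rewrite !convRE /= !mulr0 !addr0 expR0 lnK ?posrE// /powR gt_eqF// => h.
apply: le_trans h _; rewrite /= /unstable.onem; lra.
Qed.

(** The contraction factor [s / (s + beta)] is at most
    [(s / (s + 1)) `^ m]. *)
Lemma contraction_factor_powR_le s beta m : 0 < s -> 0 <= m <= 1 -> m <= beta ->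
  s / (s + beta) * (s + 1) `^ m <= s `^ m.
Proof.
move=> s0 /[dup] /andP[m0 m1] m01 mb.
have -> : s + 1 = s * (1 + s^-1) by rewrite mulrDr mulr1 divff ?gt_eqF.
have si0 : 0 < s^-1 by rewrite invr_gt0.
rewrite powRM; [|lra|lra].
rewrite mulrCA ler_piMr ?powR_ge0//.
have h := powR1D_le _ _ (ltW si0) m01.
have sb : 0 < s + beta by lra.
rewrite mulrAC ler_pdivrMr// mul1r.
apply: (le_trans (ler_wpM2l (ltW s0) h)).
by rewrite mulrDr mulr1 mulrCA divff ?gt_eqF// mulr1 lerD2l.
Qed.

(** A nonnegative sequence contracted by [(k + c) / (k + c + beta)] at step [k]
    is [O(k^(- m))] for every [m] in [0, 1] with [m <= beta]. *)
Lemma powR_decay c beta m e : 0 < c -> 0 <= m <= 1 -> m <= beta ->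
    (forall k, 0 <= e k) ->
    (forall k, e k.+1 <= (k%:R + c) / (k%:R + c + beta) * e k) ->
  forall k, e k * (k%:R + c) `^ m <= e 0%N * c `^ m.
Proof.
move=> c0 m01 mb e0 eS; elim=> [|k IH]; first by rewrite add0r.
apply: le_trans IH.
have k0 : 0 < k%:R + c by rewrite ltr_wpDl.
have -> : k.+1%:R + c = (k%:R + c) + 1 by rewrite -natr1 addrAC.
apply: (le_trans (ler_wpM2r (powR_ge0 _ _) (eS k))).
rewrite mulrAC mulrC ler_wpM2l//.
exact: contraction_factor_powR_le.
Qed.

Lemma powR_unbounded c m B : 0 < m -> 0 <= c ->
  exists K, forall k, (K <= k)%N -> B <= (k%:R + c) `^ m.
Proof.
move=> m0 c0; have [B0|B0] := leP B 0.
  by exists 0%N => k _; rewrite (le_trans B0)// powR_ge0.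
have [K hK] : exists K : nat, B `^ m^-1 <= K%:R.
  exists (Num.truncn (B `^ m^-1)).+1.
  by apply/ltW/truncnS_gt.
exists K => k Kk.
have -> : B = (B `^ m^-1) `^ m.
  by rewrite -powRrM mulVf ?gt_eqF// powRr1// ltW.
apply: (ge0_ler_powR (ltW m0)); rewrite ?nnegrE ?powR_ge0 ?addr_ge0//.
by rewrite (le_trans hK)// ler_wpDr// ler_nat.
Qed.

End PowerDecay.

(** * Inner product identities *)

Section HilbertIdentities.
Context {R : realType} {H : hilbertType R}.
Implicit Types (x y z u w : H) (t : R).

Lemma innerNl x y : inner (- x) y = - inner x y.
Proof. exact: linearNl. Qed.

Lemma innerNr x y : inner x (- y) = - inner x y.
Proof. exact: linearNr. Qed.

(** Turns an identity between linear combinations of vectors into an identity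
    between scalars. *)
Lemma inner_inj u w : (forall z, inner u z = inner w z) -> u = w.
Proof.
move=> uw; apply/eqP; rewrite -subr_eq0 -normr_eq0 -sqrf_eq0 sqr_norm.
by rewrite innerBl uw subrr.
Qed.

Definition innerE :=
  (@innerDl R H, @innerBl R H, @innerZl R H, innerNl,
   @innerDr R H, @innerBr R H, @innerZr R H, innerNr).

Lemma sqr_normB x y : `|x - y| ^+ 2 = `|x| ^+ 2 - 2 * inner x y + `|y| ^+ 2.
Proof. by rewrite !sqr_norm !innerE (innerC y x); ring. Qed.

Lemma sqr_normD x y : `|x + y| ^+ 2 = `|x| ^+ 2 + 2 * inner x y + `|y| ^+ 2.
Proof. by rewrite !sqr_norm !innerE (innerC y x); ring. Qed.

Lemma inner_le_norm x y : inner x y <= `|x| * `|y|.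
Proof.
have : `|x + y| ^+ 2 <= (`|x| + `|y|) ^+ 2.
  by rewrite ler_pXn2r ?nnegrE ?addr_ge0// ler_normD.
rewrite sqr_normD sqrrD; lra.
Qed.

End HilbertIdentities.

(** * Browder's path *)

Section BrowderPath.
Context {R : realType} {H : hilbertType R} (T : H -> H).
Hypothesis neT : nonexpansive T.
Implicit Types (x y z v p : H) (mu nu : R).

(** [I - T] is cocoercive; in particular it is monotone. *)
Lemma residual_cocoercive x y :
  `|(x - T x) - (y - T y)| ^+ 2 <= 2 * inner (x - y) ((x - T x) - (y - T y)).
Proof.
have : `|T x - T y| ^+ 2 <= `|x - y| ^+ 2 by rewrite ler_pXn2r ?nnegrE.
have -> : T x - T y = (x - y) - ((x - T x) - (y - T y)).
  by apply: inner_inj => z; rewrite !innerE; ring.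
rewrite (sqr_normB (x - y)); lra.
Qed.

Lemma residual_monotone x y : 0 <= inner (x - y) ((x - T x) - (y - T y)).
Proof.
have := residual_cocoercive x y.
have := sqr_ge0 `|(x - T x) - (y - T y)|; lra.
Qed.

(** [z] is the point of Browder's path towards [v] with parameter [mu]:
    equivalently [z = t *: v + (1 - t) *: T z] with [t = mu / (1 + mu)]. *)
Definition browder_point v mu z := z - T z = mu *: (v - z).

Lemma browder_point_exists v mu : 0 < mu -> exists z, browder_point v mu z.
Proof.
move=> mu0.
have q0 : 0 <= (1 + mu)^-1 by rewrite invr_ge0; lra.
have mu1 : 1 + mu != 0 by rewrite gt_eqF//; lra.
pose f := fun z : H => (1 + mu)^-1 *: (mu *: v + T z).
have funf : {homo f : z / [set: H] z >-> [set: H] z} by [].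
pose F : {fun [set: H] >-> [set: H]} := mkfun funf.
have ctr : is_contraction F.
  exists (NngNum q0); split=> /=.
    by rewrite invf_lt1; lra.
  move=> [z w] _ /=; rewrite /f -scalerBr normrZ ger0_norm// ler_wpM2l//.
  by rewrite opprD addrACA subrr add0r; exact: neT.
have [|//|z _ /= zE] := banach_fixed_point ctr.
- exact: closedT.
- by exists 0.
exists z; rewrite /browder_point.
have /(congr1 (fun u => (1 + mu) *: u)) : z = f z by exact: zE.
rewrite /f scalerA mulfV// scale1r => {}zE.
have -> : T z = (1 + mu) *: z - mu *: v by rewrite zE addrAC subrr add0r.
by apply: inner_inj => w; rewrite !innerE; ring.
Qed.

(** [|v - z|] grows as the parameter decreases, and its increments control
    the distances along the path: this is what makes the path Cauchy. *)
Lemma browder_dist_sqr v mu nu y z : 0 < nu -> nu < mu ->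
    browder_point v mu y -> browder_point v nu z ->
  `|z - y| ^+ 2 <= `|v - z| ^+ 2 - `|v - y| ^+ 2.
Proof.
move=> nu0 numu yP zP; rewrite leNgt; apply/negP => ltD.
have D0 := sqr_ge0 `|z - y|.
(* Monotonicity of [I - T] between [y] and [z]. *)
have h : (mu + nu) * `|z - y| ^+ 2 <=
         (mu - nu) * (`|v - z| ^+ 2 - `|v - y| ^+ 2).
  have := residual_monotone y z; rewrite yP zP.
  rewrite !sqr_norm !innerE (innerC y z) (innerC y v) (innerC z v); lra.
move: (`|z - y| ^+ 2) (_ - _) D0 h ltD => D E D0 h ltD.
nra.
Qed.

(** Points of the path are at least as close to [v] as any fixed point. *)
Lemma browder_norm_le v mu z p : 0 < mu -> browder_point v mu z -> Fix T p ->
  `|v - z| <= `|v - p|.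
Proof.
move=> mu0 zP pF.
have := residual_monotone z p; rewrite zP -[in p - T p]pF subrr subr0 innerZr.
rewrite pmulr_rge0// => h.
rewrite -(@ler_pXn2r _ 2)// ?nnegrE//.
have -> : v - p = (v - z) + (z - p) by rewrite addrA subrK.
rewrite (sqr_normD (v - z)) (innerC (v - z)).
have := sqr_ge0 `|z - p|; lra.
Qed.

(** Browder's path converges strongly to the projection onto the fixed
    points. *)
Lemma browder_path_cvg v p : is_metric_projection (Fix T) v p ->
  forall eps, 0 < eps ->
  exists mu z, [/\ 0 < mu, browder_point v mu z & `|z - p| <= eps].
Proof.
move=> pP; have Tp := pP.1.
have mu_gt0 n : 0 < n.+1%:R^-1 :> R by rewrite invr_gt0.
have /choice[z zP] n := browder_point_exists v _ (mu_gt0 n).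
pose w := fun n => `|v - z n| ^+ 2.
have dist_le m n : (m <= n)%N -> `|z n - z m| ^+ 2 <= w n - w m.
  rewrite leq_eqVlt => /predU1P[->|mn]; first by rewrite !subrr normr0 expr0n.
  apply: (browder_dist_sqr v m.+1%:R^-1 n.+1%:R^-1) => //.
  by rewrite ltf_pV2 ?posrE// ltr_nat.
have w_nd : nondecreasing_seq w.
  by move=> m n mn; rewrite -subr_ge0 (le_trans _ (dist_le _ _ mn)) ?sqr_ge0.
have z_le n : `|v - z n| <= `|v - p| by apply: (browder_norm_le _ n.+1%:R^-1).
have w_cvg : cvgn w.
  apply: nondecreasing_is_cvgn => //; exists (`|v - p| ^+ 2) => _ [n _ <-].
  by rewrite /w ler_pXn2r ?nnegrE.
have /cvg_ex[/= q zq] : cvg (z @ \oo).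
  apply/cauchy_cvgP/cauchy_exP => e e0.
  have [N _ hN] : \forall n \near \oo, limn w - w n < e ^+ 2.
    have /cvgrPdist_lt/(_ (e ^+ 2)) := w_cvg.
    move=> /(_ (exprn_gt0 _ e0)); apply: filterS => n.
    exact: le_lt_trans (ler_norm _).
  exists (z N), N => // n /= Nn; rewrite -ball_normE/= distrC.
  rewrite -(@ltr_pXn2r _ 2)// ?nnegrE ?(ltW e0)//.
  apply: (le_lt_trans (dist_le _ _ Nn)).
  apply: le_lt_trans (hN N (leqnn N)); rewrite lerD2r.
  exact: nondecreasing_cvgn_le.
have /cvgrPdist_le zq' := zq.
have q_le : `|v - q| <= `|v - p|.
  apply/ler_addgt0Pr => e e0; near \oo => n.
  rewrite -(subrKA (z n)) (le_trans (ler_normD _ _))// lerD ?z_le//.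
  by rewrite distrC; near: n; exact: zq'.
have Fq : Fix T q.
  apply/eqP; rewrite -subr_eq0 -normr_le0; apply/ler_addgt0Pr => e e0.
  rewrite add0r; have e3 : 0 < e / 3 by rewrite divr_gt0.
  near \oo => n.
  have h1 : `|q - z n| <= e / 3 by near: n; exact: zq'.
  have h2 : n.+1%:R^-1 * `|v - p| <= e / 3.
    near: n; have [N _ hN] : \forall n \near \oo,
        n.+1%:R^-1 < e / 3 / (`|v - p| + 1).
      have /cvgrPdist_lt h : (fun n : nat => n.+1%:R^-1 : R) @ \oo --> (0 : R).
        exact: cvg_harmonic.
      have /h : 0 < e / 3 / (`|v - p| + 1) by rewrite divr_gt0// ltr_wpDl.
      by apply: filterS => n; rewrite sub0r normrN ger0_norm// ltW.
    exists N => // n /hN /ltW.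
    rewrite ler_pdivlMr ?ltr_wpDl//; apply: le_trans.
    by rewrite ler_wpM2l ?(ltW (mu_gt0 _))// lerDl.
  have h3 : `|z n - T (z n)| <= e / 3.
    rewrite zP normrZ ger0_norm ?(ltW (mu_gt0 _))//.
    by apply: le_trans h2; rewrite ler_wpM2l ?(ltW (mu_gt0 _)).
  have h4 : `|T (z n) - T q| <= e / 3 by rewrite (le_trans (neT _ _))// distrC.
  have -> : q - T q = (q - z n) + (z n - T (z n)) + (T (z n) - T q).
    by rewrite !addrA !subrK.
  have := ler_normD (q - z n + (z n - T (z n))) (T (z n) - T q).
  have := ler_normD (q - z n) (z n - T (z n)); lra.
have qp : q = p.
  apply: (metric_projection_unique (v := v) (convex_Fix neT)) => //.
  by split=> // y Fy; exact: le_trans q_le (pP.2 y Fy).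
move=> eps eps0; rewrite {}qp in zq'.
near \oo => n; exists n.+1%:R^-1, (z n); split=> //.
by rewrite distrC; near: n; exact: zq'.
Unshelve. all: by end_near. Qed.

(** Strong substitute for the demiclosedness of [I - T]: approximate fixed
    points almost satisfy the variational inequality of the projection. *)
Lemma approx_fixed_variational v p M eps :
    is_metric_projection (Fix T) v p -> 0 <= M -> 0 < eps ->
  exists2 delta, 0 < delta & forall x, `|x - p| <= M -> `|x - T x| <= delta ->
    inner (v - p) (x - p) <= eps.
Proof.
move=> pP M0 eps0.
set D := `|v - p|; have D0 : 0 <= D by exact: normr_ge0.
pose eta := Num.min 1 (eps / 2 / (M + 1 + D)).
have eta0 : 0 < eta.
  by rewrite lt_min ltr01/= !divr_gt0//; lra.
have eta1 : eta <= 1 by rewrite ge_min lexx.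
have etaE : eta * (M + 1 + D) <= eps / 2.
  by rewrite -ler_pdivlMr ?ge_min ?lexx ?orbT//; lra.
have [mu [z [mu0 zP zp]]] := browder_path_cvg _ _ pP _ eta0.
exists (mu * (eps / 2 / (M + 1))); first by rewrite mulr_gt0 ?divr_gt0 ?ltr_wpDl.
move=> x xM xT.
have xz : `|x - z| <= M + 1.
  have -> : x - z = (x - p) - (z - p) by rewrite opprB addrA subrK.
  by have := ler_normB (x - p) (z - p); lra.
have i1 : inner (v - z) (x - z) <= eps / 2.
  have := residual_monotone x z; rewrite zP innerBr innerZr subr_ge0 => h.
  have := le_trans h (inner_le_norm _ _).
  have := ler_pM (normr_ge0 _) (normr_ge0 _) xz xT.
  rewrite [leRHS](_ : _ = mu * (eps / 2)); last by field; rewrite gt_eqF//; lra.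
  move=> h1 h2; have := le_trans h2 h1.
  by rewrite ler_pM2l// innerC.
have i2 : inner (z - p) (x - z) <= eta * (M + 1).
  by apply: (le_trans (inner_le_norm _ _)); apply: ler_pM.
have i3 : inner (v - p) (z - p) <= eta * D.
  by apply: (le_trans (inner_le_norm _ _)); rewrite mulrC; apply: ler_pM.
have -> : inner (v - p) (x - p) = inner (v - z) (x - z) +
    inner (z - p) (x - z) + inner (v - p) (z - p) by rewrite !innerE; ring.
move: etaE; rewrite mulrDr; lra.
Qed.

End BrowderPath.

(** * The anchored iteration *)

Section Halpern.
Context {R : realType} {H : hilbertType R} (T : H -> H).
Hypothesis neT : nonexpansive T.
Context (alpha : R) (v : H) (x : nat -> H).
Hypothesis alpha_gt1 : 1 < alpha.
Let lambda (k : nat) : R := (alpha - 1) / (k%:R + alpha).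
Hypothesis xS : forall k, x k.+1 = lambda k *: v + (1 - lambda k) *: T (x k).
Implicit Types (p : H) (k n : nat).

Let denom_gt0 k : 0 < k%:R + alpha.
Proof. by rewrite ltr_wpDl// (lt_trans _ alpha_gt1). Qed.

Let lambda_gt0 k : 0 < lambda k.
Proof. by rewrite divr_gt0// subr_gt0. Qed.

Let lambdaC k : 1 - lambda k = (k%:R + 1) / (k%:R + alpha).
Proof. by rewrite /lambda; field; rewrite gt_eqF. Qed.

Let lambdaC_gt0 k : 0 < 1 - lambda k.
Proof. by rewrite lambdaC divr_gt0// ltr_wpDl. Qed.

Lemma halpern_bounded p k : Fix T p -> `|x k - p| <= `|x 0%N - p| + `|v - p|.
Proof.
move=> Tp; elim: k => [|k IH]; first by rewrite lerDl.
have -> : x k.+1 - p = lambda k *: (v - p) + (1 - lambda k) *: (T (x k) - p).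
  by rewrite xS; apply: inner_inj => z; rewrite !innerE; ring.
apply: (le_trans (ler_normD _ _)).
rewrite (normrZ (lambda k)) (normrZ (1 - _)).
rewrite (gtr0_norm (lambda_gt0 k)) (gtr0_norm (lambdaC_gt0 k)).
have h : `|T (x k) - p| <= `|x k - p| by rewrite [in leLHS]Tp.
have l0 := lambda_gt0 k; have l1 := lambdaC_gt0 k.
have h0 := normr_ge0 (x 0%N - p).
have := ler_wpM2l (ltW l1) (le_trans h IH).
have := mulr_ge0 (ltW l0) h0; lra.
Qed.

Lemma halpern_anchor_bounded p k : Fix T p ->
  `|v - T (x k)| <= `|x 0%N - p| + 2 * `|v - p|.
Proof.
move=> Tp; have -> : v - T (x k) = (v - p) - (T (x k) - p).
  by rewrite opprB addrA subrK.
have h : `|T (x k) - p| <= `|x k - p| by rewrite [in leLHS]Tp.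
have := halpern_bounded _ k Tp.
have := ler_normB (v - p) (T (x k) - p); lra.
Qed.

Lemma halpern_residualE k :
  x k - T (x k) = lambda k *: (v - T (x k)) - (x k.+1 - x k).
Proof. by rewrite xS; apply: inner_inj => z; rewrite !innerE; ring. Qed.

Lemma halpern_step_le p k : Fix T p ->
  `|x k.+2 - x k.+1| <= (k%:R + 2) / (k%:R + 2 + (alpha - 1)) * `|x k.+1 - x k|
    + (alpha - 1) * (`|x 0%N - p| + 2 * `|v - p|)
      / ((k%:R + alpha) * (k%:R + 1 + alpha)).
Proof.
move=> Tp; have alpha1 := alpha_gt1.
have -> : x k.+2 - x k.+1 = (1 - lambda k.+1) *: (T (x k.+1) - T (x k))
                            - (lambda k - lambda k.+1) *: (v - T (x k)).
  by rewrite (xS k.+1) (xS k); apply: inner_inj => z; rewrite !innerE; ring.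
have a0 := denom_gt0 k; have a1 := denom_gt0 k.+1; rewrite -natr1 in a1.
have dl : lambda k - lambda k.+1 =
    (alpha - 1) / ((k%:R + alpha) * (k%:R + 1 + alpha)).
  by rewrite /lambda -natr1; field; rewrite !gt_eqF.
have den0 : 0 <= ((k%:R + alpha) * (k%:R + 1 + alpha))^-1.
  by rewrite invr_ge0 mulr_ge0// ltW.
have dl0 : 0 <= lambda k - lambda k.+1 by rewrite dl mulr_ge0//; lra.
have lE : 1 - lambda k.+1 = (k%:R + 2) / (k%:R + 2 + (alpha - 1)).
  by rewrite lambdaC -natr1; congr (_ / _); ring.
apply: (le_trans (ler_normB _ _)).
rewrite (normrZ (1 - _)) (normrZ (_ - _)).
rewrite (gtr0_norm (lambdaC_gt0 _)) (ger0_norm dl0).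
apply: lerD; first by rewrite -lE; apply: (ler_wpM2l (ltW (lambdaC_gt0 _))).
rewrite dl mulrAC; apply: ler_wpM2r => //.
apply: ler_wpM2l; [lra | exact: halpern_anchor_bounded].
Qed.

(** For [alpha < 2] the forcing term is absorbed by adding a multiple of
    [1 / (k + alpha)] to the step length; what remains is a pure contraction
    recursion. *)
Lemma halpern_step_rate_lt2 p : Fix T p -> alpha < 2 ->
  exists B, forall k, `|x k.+1 - x k| * k.+1%:R `^ (alpha - 1) <= B.
Proof.
move=> Tp alpha2; have alpha1 := alpha_gt1.
set C := (alpha - 1) * (`|x 0%N - p| + 2 * `|v - p|).
have C0 : 0 <= C by apply: mulr_ge0; [lra | rewrite addr_ge0// mulr_ge0].
pose G := C / (2 - alpha).
have G0 : 0 <= G by rewrite divr_ge0//; lra.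
have GE : C = G * (2 - alpha) by rewrite divfK// gt_eqF//; lra.
pose e k := `|x k.+1 - x k| + G / (k%:R + alpha).
have G'0 k : 0 <= G / (k%:R + alpha) by rewrite divr_ge0// ltW.
have e0 k : 0 <= e k by rewrite addr_ge0.
have eS k : e k.+1 <= (k%:R + 2) / (k%:R + 2 + (alpha - 1)) * e k.
  have a0 := denom_gt0 k; have a1 := denom_gt0 k.+1; rewrite -natr1 in a1.
  rewrite /e mulrDr; have := halpern_step_le _ k Tp; rewrite -/C.
  suff -> : (k%:R + 2) / (k%:R + 2 + (alpha - 1)) * (G / (k%:R + alpha)) =
    C / ((k%:R + alpha) * (k%:R + 1 + alpha)) + G / (k.+1%:R + alpha) by lra.
  by rewrite GE -natr1; field; rewrite !gt_eqF//; lra.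
exists (e 0%N * 2 `^ (alpha - 1)) => k.
have m01 : 0 <= alpha - 1 <= 1 by apply/andP; split; lra.
apply: le_trans (powR_decay 2 _ _ e (ltr0Sn _ _) m01 (lexx _) e0 eS k).
apply: ler_pM; rewrite ?powR_ge0//; first by rewrite lerDl.
have m0 : 0 <= alpha - 1 by lra.
apply: (ge0_ler_powR m0); rewrite ?nnegrE ?addr_ge0//.
by rewrite -natr1; lra.
Qed.

Lemma halpern_step_rate_gt2 p : Fix T p -> 2 < alpha ->
  exists B, forall k, `|x k.+1 - x k| * k.+1%:R <= B.
Proof.
move=> Tp alpha2; have alpha1 := alpha_gt1.
set C := (alpha - 1) * (`|x 0%N - p| + 2 * `|v - p|).
have C0 : 0 <= C by apply: mulr_ge0; [lra | rewrite addr_ge0// mulr_ge0].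
(* The first summand makes the induction step work, the second covers
   [k = 0]. *)
pose D := C / (alpha - 2) + alpha * `|x 1%N - x 0%N|.
have DC : C <= D * (alpha - 2).
  rewrite /D mulrDl divfK ?gt_eqF// ?lerDl ?mulr_ge0//; lra.
have D0 : 0 <= D by rewrite addr_ge0 ?divr_ge0 ?mulr_ge0//; lra.
have h k : `|x k.+1 - x k| <= D / (k%:R + alpha).
  elim: k => [|k IH].
    rewrite add0r ler_pdivlMr; last lra.
    rewrite /D mulrC lerDr divr_ge0//; lra.
  have a0 := denom_gt0 k; have a1 := denom_gt0 k.+1; rewrite -natr1 in a1.
  apply: (le_trans (halpern_step_le _ k Tp)); rewrite -/C -(natr1 k).
  rewrite (_ : k%:R + 2 + (alpha - 1) = k%:R + 1 + alpha); last by ring.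
  have k2 : 0 <= (k%:R + 2) / (k%:R + 1 + alpha) :> R.
    by apply: divr_ge0; [rewrite addr_ge0|exact: ltW].
  apply: (le_trans (lerD (ler_wpM2l k2 IH) (lexx _))).
  have -> : (k%:R + 2) / (k%:R + 1 + alpha) * (D / (k%:R + alpha)) +
      C / ((k%:R + alpha) * (k%:R + 1 + alpha)) =
      ((k%:R + 2) * D + C) / (k%:R + alpha) / (k%:R + 1 + alpha).
    by field; rewrite !gt_eqF.
  apply: ler_wpM2r; first by rewrite invr_ge0 ltW.
  rewrite ler_pdivrMr//; lra.
exists D => k.
rewrite -ler_pdivlMr//; apply: (le_trans (h k)).
rewrite ler_wpM2l// lef_pV2 ?posrE// -natr1; lra.
Qed.

(** For [alpha = 2] the recursion on the step lengths would lose a logarithm;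
    the energy
    [k (k + 1) / 2 |x_k - T x_k|^2 + (k + 1) <x_k - v, x_k - T x_k>]
    is nonincreasing instead. This is one step of that decrease, with
    [u = x_k - v], [w = x_(k+1) - v], [a] and [b] the residuals at [x_k] and
    [x_(k+1)]; it is the cocoercivity inequality multiplied by
    [(s + 1) (s + 2) / 2]. *)
Lemma halpern_energy_step (s : R) (u w a b : H) : 0 <= s ->
    (s + 2) *: w = (s + 1) *: (u - a) ->
    `|b - a| ^+ 2 <= 2 * inner (w - u) (b - a) ->
  (s + 1) * (s + 2) / 2 * `|b| ^+ 2 + (s + 2) * inner w b <=
  s * (s + 1) / 2 * `|a| ^+ 2 + (s + 1) * inner u a.
Proof.
move=> s0 wE; rewrite !sqr_norm !innerE (innerC b a) => coco.
have := congr1 (inner ^~ a) wE; have := congr1 (inner ^~ b) wE => /=.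
rewrite !innerE.
move: (inner w a) (inner w b) (inner u a) (inner u b) (inner a b) coco.
move: (inner a a) (inner b b) => aa bb wa wb ua ub ab coco hb ha.
have c0 : 0 <= (s + 1) * (s + 2) / 2 by nra.
have h := ler_wpM2l c0 coco.
have h1 : (s + 1) * ((s + 2) * wa) = (s + 1) * ((s + 1) * (ua - aa)).
  by rewrite ha.
have h2 : (s + 2) * ((s + 2) * wb) = (s + 2) * ((s + 1) * (ub - ab)).
  by rewrite hb.
lra.
Qed.

Lemma halpern_residual_rate_eq2 p : Fix T p -> alpha = 2 ->
  exists B, forall k, `|x k - T (x k)| * k.+1%:R <= B.
Proof.
move=> Tp alpha2.
pose A k := x k - T (x k).
pose E k : R := k%:R * (k%:R + 1) / 2 * `|A k| ^+ 2
                + (k%:R + 1) * inner (x k - v) (A k).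
have ES k : E k.+1 <= E k.
  rewrite /E -natr1 (_ : k%:R + 1 + 1 = k%:R + 2); last by ring.
  apply: halpern_energy_step => //; last first.
    rewrite (_ : x k.+1 - v - (x k - v) = x k.+1 - x k).
      exact: residual_cocoercive.
    by rewrite opprB addrA subrK.
  have -> : x k.+1 - v = (1 - lambda k) *: ((x k - v) - A k).
    by rewrite xS; apply: inner_inj => z; rewrite /A !innerE; ring.
  rewrite scalerA lambdaC alpha2; congr (_ *: _); field.
  by rewrite gt_eqF// ltr_wpDl.
have E_le k : E k <= E 0%N by elim: k => // k; exact: le_trans.
exists (2 * `|E 0%N| + 2 * `|v - p| + 1) => k.
(* Dropping [v] in favour of the fixed point [p] costs only a term linear in
   the residual, so the energy controls [((k + 1) |A k|)^2 / 2]. *)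
have low : (k%:R + 1) ^+ 2 / 2 * `|A k| ^+ 2 - (k%:R + 1) * (`|v - p| * `|A k|)
    <= E k.
  have -> : E k = k%:R * (k%:R + 1) / 2 * `|A k| ^+ 2
      + (k%:R + 1) * (inner (x k - p) (A k) - inner (v - p) (A k)).
    by rewrite /E !innerE; ring.
  have k1 : 0 <= k%:R + 1 :> R by rewrite addr_ge0.
  have c1 : `|A k| ^+ 2 <= 2 * inner (x k - p) (A k).
    have := residual_cocoercive _ neT (x k) p.
    by rewrite -[in p - T p]Tp subrr subr0.
  have c2 := inner_le_norm (v - p) (A k).
  have := ler_wpM2l k1 c1; have := ler_wpM2l k1 c2; lra.
have := le_trans low (le_trans (E_le k) (ler_norm _)).
rewrite -(natr1 k) -/(A k).
have := normr_ge0 (E 0%N); have := normr_ge0 (v - p).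
have : 0 <= `|A k| * (k%:R + 1) by rewrite mulr_ge0 ?addr_ge0.
rewrite (_ : _ - _ = (`|A k| * (k%:R + 1)) ^+ 2 / 2
                     - `|v - p| * (`|A k| * (k%:R + 1))); last by ring.
move: (_ * (k%:R + 1)) `|v - p| `|E 0%N| => y d e y0 d0 e0 h.
rewrite leNgt; apply/negP => lty.
have y1 : 0 <= y - 1 by lra.
have y2 : 0 <= y - 2 * d by lra.
have := mulr_ge0 y1 y2; lra.
Qed.

Lemma halpern_rate p : Fix T p ->
  exists2 B, 0 < B & forall k,
    `|x k.+1 - x k| * k.+1%:R `^ Num.min (alpha - 1) 1 <= B /\
    `|x k - T (x k)| * k.+1%:R `^ Num.min (alpha - 1) 1 <= B.
Proof.
move=> Tp; have alpha1 := alpha_gt1.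
set m := Num.min (alpha - 1) 1.
pose q k : R := k.+1%:R `^ m.
have q0 k : 0 <= q k by exact: powR_ge0.
have q_le k : q k <= k.+1%:R.
  by apply: ler1_powR; rewrite ?ler1n// /m ge_min lexx orbT.
set C := `|x 0%N - p| + 2 * `|v - p|.
have anchor k : `|lambda k *: (v - T (x k))| * q k <= (alpha - 1) * C.
  rewrite normrZ (gtr0_norm (lambda_gt0 k)) mulrAC.
  apply: ler_pM => //.
  - by rewrite mulr_ge0// ltW.
  - apply: (le_trans (ler_wpM2l (ltW (lambda_gt0 k)) (q_le k))).
    rewrite /lambda mulrAC ler_pdivrMr// ler_pM2l ?subr_gt0//.
    by rewrite -(natr1 k) lerD2l ltW.
  - exact: halpern_anchor_bounded.
have C0 : 0 <= C by rewrite addr_ge0// mulr_ge0.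
have aC0 : 0 <= (alpha - 1) * C by apply: mulr_ge0 => //; lra.
(* By [halpern_residualE] a bound on either quantity yields one on the other. *)
suff [B hB] : exists B, (forall k, `|x k.+1 - x k| * q k <= B) \/
                        (forall k, `|x k - T (x k)| * q k <= B).
  exists (`|B| + (alpha - 1) * C + 1) => [|k]; first by have := normr_ge0 B; lra.
  have B_le := ler_norm B; have ank := anchor k.
  rewrite -/(q k); case: hB => /(_ k) hk; split; try lra.
  - have := ler_normB (lambda k *: (v - T (x k))) (x k.+1 - x k).
    rewrite -halpern_residualE => /(ler_wpM2r (q0 k)); rewrite mulrDl; lra.
  - have := ler_normB (lambda k *: (v - T (x k))) (x k - T (x k)).
    rewrite [in X in X <= _]halpern_residualE opprB addrC subrK.
    move=> /(ler_wpM2r (q0 k)); rewrite mulrDl; lra.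
have [alpha2|alpha2|alpha2] := ltgtP alpha 2.
- have [B hB] := halpern_step_rate_lt2 _ Tp alpha2.
  by exists B; left => k; rewrite /q /m min_l//; lra.
- have [B hB] := halpern_step_rate_gt2 _ Tp alpha2.
  by exists B; left => k; apply: le_trans (hB k); rewrite ler_wpM2l.
- have [B hB] := halpern_residual_rate_eq2 _ Tp alpha2.
  by exists B; right => k; apply: le_trans (hB k); rewrite ler_wpM2l.
Qed.

Lemma halpern_sqr_dist_le p k : Fix T p ->
  `|x k.+1 - p| ^+ 2 <= (1 - lambda k) * `|x k - p| ^+ 2
    + lambda k * (2 * inner (v - p) (x k.+1 - p)).
Proof.
move=> Tp.
have l0 := lambda_gt0 k; have l1 := lambdaC_gt0 k.
have h : `|T (x k) - p| ^+ 2 <= `|x k - p| ^+ 2.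
  by rewrite ler_pXn2r ?nnegrE// [in leLHS]Tp.
have -> : x k.+1 - p = (1 - lambda k) *: (T (x k) - p) + lambda k *: (v - p).
  by rewrite xS; apply: inner_inj => z; rewrite !innerE; ring.
move: (lambda k) l0 l1 (T (x k) - p) (v - p) h => l l0 l1 a b h.
rewrite (sqr_normD (_ *: a)) (normrZ _ a) (normrZ _ b) !exprMn !real_normK ?num_real//.
rewrite innerDr !innerZr innerZl (innerC b a) -(sqr_norm b).
have := ler_wpM2l (ltW l1) h.
have := mulr_ge0 (ltW (mulr_gt0 l0 l1)) (sqr_ge0 `|a|).
have := mulr_ge0 (sqr_ge0 l) (sqr_ge0 `|b|); lra.
Qed.

(** Once the variational inequality nearly holds along the tail of the
    sequence, the squared distance to the projection obeys a contraction
    recursion up to an error [eps], so it is eventually at most [2 eps]. *)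
Lemma halpern_cvg p : is_metric_projection (Fix T) v p -> x @ \oo --> p.
Proof.
move=> pP; have Tp := pP.1; have alpha1 := alpha_gt1.
set m := Num.min (alpha - 1) 1.
have m0 : 0 < m by rewrite lt_min ltr01 andbT; lra.
have m01 : 0 <= m <= 1 by rewrite (ltW m0)/= /m ge_min lexx orbT.
have ma : m <= alpha - 1 by rewrite /m ge_min lexx.
have eventually_le eps : 0 < eps ->
    exists N, forall k, (N <= k)%N -> `|x k - p| ^+ 2 <= 2 * eps.
  move=> eps0.
  have M0 : 0 <= `|x 0%N - p| + `|v - p| by rewrite addr_ge0.
  have e2 : 0 < eps / 2 by rewrite divr_gt0.
  have [delta delta0 hd] := approx_fixed_variational _ neT _ _ _ _ pP M0 e2.
  have [B B0 hB] := halpern_rate _ Tp.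
  have [K hK] := powR_unbounded 1 m (B / delta) m0 ler01.
  have var k : (K <= k)%N -> 2 * inner (v - p) (x k.+1 - p) <= eps.
    move=> Kk; rewrite mulrC -ler_pdivlMr//.
    apply: hd; first exact: halpern_bounded.
    have qk := hK k.+1 (leqW Kk); rewrite natr1 in qk.
    have := (hB k.+1).2; rewrite -/m => hk.
    have q0 : 0 < k.+2%:R `^ m by rewrite powR_gt0.
    rewrite -(ler_pM2r q0) (le_trans hk)// mulrC -ler_pdivrMr//.
  pose e j := Num.max (`|x (K + j)%N - p| ^+ 2 - eps) 0.
  have e_ge0 j : 0 <= e j by rewrite le_max lexx orbT.
  have eS j : e j.+1 <= (j%:R + K.+1%:R) / (j%:R + K.+1%:R + (alpha - 1)) * e j.
    have -> : (j%:R + K.+1%:R) / (j%:R + K.+1%:R + (alpha - 1)) =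
        1 - lambda (K + j).
      by rewrite lambdaC natrD -natr1; congr (_ / _); ring.
    have l0 := lambda_gt0 (K + j); have l1 := lambdaC_gt0 (K + j).
    rewrite {1}/e ge_max mulr_ge0 ?(ltW l1)// andbT addnS.
    have he : `|x (K + j)%N - p| ^+ 2 - eps <= e j by rewrite le_max lexx.
    have := halpern_sqr_dist_le _ (K + j) Tp.
    have := ler_wpM2l (ltW l1) he.
    have := ler_wpM2l (ltW l0) (var _ (leq_addr j K)); lra.
  have decay := powR_decay _ _ _ e (ltr0Sn _ K) m01 ma e_ge0 eS.
  have [J hJ] := powR_unbounded K.+1%:R m (e 0%N * K.+1%:R `^ m / eps) m0 (ler0n _ _).
  exists (K + J)%N => k Kk; rewrite -(subnKC (leq_trans (leq_addr _ _) Kk)).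
  set j := (k - K)%N; have Jj : (J <= j)%N by rewrite leq_subRL ?(leq_trans _ Kk)// leq_addr.
  have : e j <= eps.
    have q0 : 0 < (j%:R + K.+1%:R) `^ m by rewrite powR_gt0// ltr_wpDl.
    rewrite -(ler_pM2r q0) (le_trans (decay j))// [leRHS]mulrC -ler_pdivrMr//.
    exact: hJ.
  by rewrite ge_max => /andP[]; lra.
apply/cvgrPdist_lt => r r0.
have r2 : 0 < r ^+ 2 / 4 by rewrite divr_gt0// exprn_gt0.
have [N hN] := eventually_le _ r2.
exists N => // k /= /hN h; rewrite distrC -(@ltr_pXn2r _ 2)// ?nnegrE ?(ltW r0)//.
lra.
Qed.

End Halpern.

Theorem theorem4p6 (R : realType) (H : hilbertType R) (T : H -> H)
    (T_nonexpansive : nonexpansive T) (FixT_neq0 : Fix T !=set0)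
    (alpha : R) (alpha_gt1 : 1 < alpha) (x0 v : H) (x : nat -> H)
    (x_0 : x 0%N = x0)
    (x_S : forall k : nat,
      x k.+1 = ((alpha - 1) / (k%:R + alpha)) *: v
               + (1 - (alpha - 1) / (k%:R + alpha)) *: T (x k)) :
  ((fun k : nat => `|x k.+1 - x k|)
     =O_\oo (fun k : nat => 1 / k%:R `^ Num.min (alpha - 1) 1) /\
   (fun k : nat => `|x k.+1 - T (x k.+1)|)
     =O_\oo (fun k : nat => 1 / k%:R `^ Num.min (alpha - 1) 1)) /\
  x @ \oo --> metric_projection (Fix T) v.
Proof.
have pP := metric_projection_Fix v T_nonexpansive FixT_neq0.
split; last exact: (halpern_cvg _ T_nonexpansive _ _ _ alpha_gt1 x_S).
have [B B0 hB] := halpern_rate _ T_nonexpansive _ _ _ alpha_gt1 x_S _ pP.1.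
set m := Num.min (alpha - 1) 1 in hB *.
have m0 : 0 <= m by rewrite le_min ler01 andbT subr_ge0 ltW.
have bigO (f : nat -> R) (n : nat -> nat) : (forall k, 0 <= f k) ->
    (forall k, (k <= n k)%N) -> (forall k, f k * (n k)%:R `^ m <= B) ->
    f =O_\oo (fun k : nat => 1 / k%:R `^ m).
  move=> f0 n_ge hf; apply/eqO_exP; exists B => //.
  exists 1%N => // k /= k_gt0.
  have q0 : 0 < k%:R `^ m by rewrite powR_gt0// ltr0n.
  rewrite !ger0_norm ?divr_ge0 ?powR_ge0// mulrA mulr1 ler_pdivlMr//.
  apply: le_trans (hf k); rewrite ler_wpM2l//.
  by apply: (ge0_ler_powR m0); rewrite ?nnegrE// ler_nat.
split.
- by apply: (bigO _ S) => // k; exact: (hB k).1.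
- by apply: (bigO _ (fun k => k.+2)) => [//|k|k]; [exact: leqW|exact: (hB k.+1).2].
Qed.
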